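(* Let $\Sigma$ be a finite alphabet and let $L\subseteq\Sigma^*$. 1. If $L$ is regular, then $\mathcal H_L$ has finite rank and $$\operatorname{dist}\bigl(\mathcal H_L,\mathcal F(\ell_1(\Sigma^* ),\ell_\infty(\Sigma^* ))\bigr)=\operatorname{dist}\bigl(\mathcal H_L,\mathcal K(\ell_1(\Sigma^* ),\ell_\infty(\Sigma^* ))\bigr)=0.$$ 2. If $L$ is nonregular, then $$\operatorname{dist}\bigl(\mathcal H_L,\mathcal F(\ell_1(\Sigma^* ),\ell_\infty(\Sigma^* ))\bigr)=\operatorname{dist}\bigl(\mathcal H_L,\mathcal K(\ell_1(\Sigma^* ),\ell_\infty(\Sigma^* ))\bigr)=\frac12$$ and $a_n(\mathcal H_L)=\frac12$ for every $n\geq2$.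
   Context: All Banach spaces are real. $\Sigma$ is a finite nonempty alphabet, $\Sigma^*$ the free monoid of finite words over $\Sigma$; $\mathbf 1_L$ is the characteristic function of $L$. A language is regular if it is recognized by a finite deterministic automaton. $\ell_1(\Sigma^* )$ is the space of absolutely summable real families indexed by $\Sigma^*$ with norm $\|a\|_1=\sum_u|a(u)|$; $\ell_\infty(\Sigma^* )$ is the space of bounded real functions on $\Sigma^*$ with the supremum norm. The language Hankel operator is the bounded linear operator $\mathcal H_L:\ell_1(\Sigma^* )\to\ell_\infty(\Sigma^* )$, $(\mathcal H_La)(v)=\sum_{u\in\Sigma^*}a(u)\mathbf 1_L(uv)$. For Banach spaces $X,Y$, $\mathcal L(X,Y)$, $\mathcal F(X,Y)$, $\mathcal K(X,Y)$ denote the bounded, finite-rank (bounded), and compact linear operators $X\to Y$. For $T\in\mathcal L(X,Y)$ and $\mathcal M\subseteq\mathcal L(X,Y)$, $\operatorname{dist}(T,\mathcal M)=\inf_{S\in\mathcal M}\|T-S\|$ (operator norm). The $n$-th approximation number is $a_n(T)=\inf\{\|T-R\|:R\in\mathcal L(X,Y),\ \operatorname{rank}R<n\}$, $n\in\mathbb N$. *)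

(* Defs.v *)
From HB Require Import structures.
From mathcomp Require Import all_boot all_order all_algebra.
From mathcomp Require Import lra.
From mathcomp Require Import all_classical all_reals all_analysis.

Set Implicit Arguments.
Unset Strict Implicit.
Unset Printing Implicit Defensive.

Import Order.TTheory GRing.Theory Num.Theory.
Import numFieldNormedType.Exports.

Local Open Scope classical_set_scope.
Local Open Scope ring_scope.

Section Languages.
Variable Sigma : finType.

Record dfa := DFA {
  dfa_state : finType;
  dfa_start : dfa_state;
  dfa_step : dfa_state -> Sigma -> dfa_state;
  dfa_accept : {set dfa_state} }.

Definition dfa_accepts (A : dfa) (w : seq Sigma) : bool :=
  foldl (@dfa_step A) (dfa_start A) w \in dfa_accept A.

Definition regular (L : set (seq Sigma)) : Prop :=
  exists A : dfa, L = [set w | dfa_accepts A w].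

End Languages.

Section Operators.
Variables (R : realType) (X Y : normedModType R).
Implicit Types (S T : {linear X -> Y}) (M : set {linear X -> Y}).

(* Only meaningful for bounded [f]: [sup] is 0 on unbounded sets. *)
Definition op_norm (f : X -> Y) : R := sup [set `|f x| | x in [set x | `|x| <= 1]].

(* For a linear map between normed spaces, continuous = bounded
   ([linear_bounded_continuous]). *)
Definition bounded_op : set {linear X -> Y} := [set T | continuous T].

Definition lin_indep (k : nat) (e : 'I_k -> Y) : Prop :=
  forall c : 'I_k -> R, \sum_(i < k) c i *: e i = 0 -> forall i, c i = 0.

(* [has_rank T k]: the range of [T] has a basis with [k] elements. *)
Definition has_rank T (k : nat) : Prop :=
  exists2 e : 'I_k -> Y, lin_indep e &
    range T = [set \sum_(i < k) c i *: e i | c in [set: 'I_k -> R]].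

Definition finite_rank T : Prop := exists k, has_rank T k.

Definition finite_rank_op : set {linear X -> Y} := bounded_op `&` finite_rank.

Definition compact_op : set {linear X -> Y} :=
  bounded_op `&` [set T | precompact (T @` [set x | `|x| <= 1])].

Definition op_dist T M : R := inf [set op_norm (T \- S) | S in M].

Definition rank_lt_op (n : nat) : set {linear X -> Y} :=
  bounded_op `&` [set T | exists2 k, (k < n)%N & has_rank T k].

Definition approx_number (n : nat) T : R := op_dist T (rank_lt_op n).

End Operators.
Arguments bounded_op {R} X Y.
Arguments finite_rank_op {R} X Y.
Arguments compact_op {R} X Y.
Arguments rank_lt_op {R} X Y n.

Section UnorderedSum.
Variables (R : realType) (I : choiceType).
Implicit Types f g : I -> R.

Definition abs_summable f : Prop := summable [set: I] (EFin \o f).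

Definition norm1 f : R := fine (\esum_(i in [set: I]) `|f i|%:E).

(* The sum of a real family that is absolutely summable; [esum] itself is only
   meant for nonnegative families. *)
Definition rsum f : R :=
  fine (\esum_(i in [set: I]) (EFin \o f)^\+ i -
        \esum_(i in [set: I]) (EFin \o f)^\- i)%E.

Lemma abs_summableE f :
  abs_summable f = (\esum_(i in [set: I]) `|f i|%:E < +oo)%E.
Proof. by []. Qed.

Lemma esum_pZl f c : 0 <= c -> (forall i, 0 <= f i) ->
  (\esum_(i in [set: I]) (c * f i)%:E =
   c%:E * \esum_(i in [set: I]) (f i)%:E)%E.
Proof.
move=> c0 f0; rewrite /esum -ereal_supZl//; last first.
  by apply/set0P; exists (\sum_(x \in set0) (f x)%:E)%E; exists set0 => //; exact: fsets_set0.
rewrite image_comp; congr ereal_sup; apply: eq_imagel => A _ /=.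
by rewrite ge0_mule_fsumr.
Qed.

Lemma abs_summable_le f g : (forall i, `|f i| <= `|g i|) ->
  abs_summable g -> abs_summable f.
Proof.
move=> fg; rewrite !abs_summableE; apply: le_lt_trans.
by apply: le_esum => i _; rewrite lee_fin.
Qed.

Lemma abs_summableD f g :
  abs_summable f -> abs_summable g -> abs_summable (f \+ g).
Proof. exact: summableD. Qed.

Lemma abs_summableZ c f : abs_summable f -> abs_summable (fun i => c * f i).
Proof.
rewrite !abs_summableE => sf.
under eq_esum do rewrite normrM.
rewrite esum_pZl// lte_mul_pinfty// ge0_fin_numE ?esum_ge0// => *.
Qed.

Lemma norm1E f : abs_summable f ->
  (norm1 f)%:E = \esum_(i in [set: I]) `|f i|%:E.
Proof. by move=> sf; rewrite fineK// ge0_fin_numE ?esum_ge0// => *; rewrite lee_fin. Qed.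

Lemma norm1_ge0 f : 0 <= norm1 f.
Proof. by rewrite fine_ge0// esum_ge0// => i _; rewrite lee_fin. Qed.

Lemma norm1D f g : abs_summable f -> abs_summable g ->
  norm1 (f \+ g) <= norm1 f + norm1 g.
Proof.
move=> sf sg; rewrite -lee_fin EFinD !norm1E//; last exact: abs_summableD.
rewrite -esumD => [|*|*]; [|by rewrite lee_fin..].
by apply: le_esum => i _; rewrite -EFinD lee_fin ler_normD.
Qed.

Lemma norm1Z c f : abs_summable f -> norm1 (fun i => c * f i) = `|c| * norm1 f.
Proof.
move=> sf; apply: EFin_inj; rewrite EFinM !norm1E//; last exact: abs_summableZ.
by under eq_esum do rewrite normrM; rewrite esum_pZl.
Qed.

Lemma norm1_ge f i : abs_summable f -> `|f i| <= norm1 f.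
Proof.
move=> sf; rewrite -lee_fin norm1E//.
rewrite -(@esum_set1 R I i (fun i => `|f i|%:E)) ?lee_fin//.
rewrite esum_mkcond; apply: le_esum => j _.
by case: ifP; rewrite lee_fin.
Qed.

Lemma norm1_eq0 f : abs_summable f -> norm1 f = 0 -> forall i, f i = 0.
Proof.
move=> sf f0 i; apply/eqP; rewrite -normr_le0 -f0; exact: norm1_ge.
Qed.

Lemma ge0_norm1E f : (forall i, 0 <= f i) -> abs_summable f ->
  (norm1 f)%:E = \esum_(i in [set: I]) (f i)%:E.
Proof. by move=> f0 sf; rewrite norm1E//; apply: eq_esum => i _; rewrite ger0_norm. Qed.

Lemma rsumB f g : (forall i, 0 <= f i) -> (forall i, 0 <= g i) ->
  abs_summable f -> abs_summable g ->
  rsum (f \- g) = norm1 f - norm1 g.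
Proof.
move=> f0 g0 sf sg; rewrite /rsum.
have -> : EFin \o (f \- g) = ((EFin \o f) \- (EFin \o g))%E by apply/funext.
rewrite esumB//; [|by move=> i _; rewrite lee_fin..].
by rewrite -!ge0_norm1E.
Qed.

Definition rpos f : I -> R := fun i => (`|f i| + f i) / 2.
Definition rneg f : I -> R := fun i => (`|f i| - f i) / 2.

Lemma rposneg f : f = rpos f \- rneg f.
Proof.
by apply/funext => i; rewrite /rpos /rneg /=; lra.
Qed.

Lemma rpos_ge0 f i : 0 <= rpos f i.
Proof. by rewrite divr_ge0// -lerBlDr sub0r -normrN ler_norm. Qed.

Lemma rneg_ge0 f i : 0 <= rneg f i.
Proof. by rewrite divr_ge0// subr_ge0 ler_norm. Qed.

Lemma rpos_summable f : abs_summable f -> abs_summable (rpos f).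
Proof.
apply: abs_summable_le => i; rewrite ger0_norm ?rpos_ge0//.
by rewrite ler_pdivrMr// mulr_natr mulr2n lerD2l ler_norm.
Qed.

Lemma rneg_summable f : abs_summable f -> abs_summable (rneg f).
Proof.
apply: abs_summable_le => i; rewrite ger0_norm ?rneg_ge0//.
by rewrite ler_pdivrMr// mulr_natr mulr2n lerD2l -normrN ler_norm.
Qed.

Lemma ge0_norm1D f g : (forall i, 0 <= f i) -> (forall i, 0 <= g i) ->
  abs_summable f -> abs_summable g -> norm1 (f \+ g) = norm1 f + norm1 g.
Proof.
move=> f0 g0 sf sg; apply: EFin_inj; rewrite EFinD !norm1E//; last exact: abs_summableD.
rewrite -esumD => [|*|*]; [|by rewrite lee_fin..].
by apply: eq_esum => i _; rewrite -EFinD !ger0_norm ?addr_ge0.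
Qed.

Lemma rsumE f : abs_summable f -> rsum f = norm1 (rpos f) - norm1 (rneg f).
Proof.
move=> sf; rewrite [in LHS](rposneg f) rsumB//.
- exact: rpos_ge0.
- exact: rneg_ge0.
- exact: rpos_summable.
- exact: rneg_summable.
Qed.

Lemma rsumD f g : abs_summable f -> abs_summable g ->
  rsum (f \+ g) = rsum f + rsum g.
Proof.
move=> sf sg; have := (rpos_ge0, rneg_ge0) => pn0.
have [spf spg] := (rpos_summable sf, rpos_summable sg).
have [snf sng] := (rneg_summable sf, rneg_summable sg).
have -> : f \+ g = (rpos f \+ rpos g) \- (rneg f \+ rneg g).
  by apply/funext => i; rewrite {1}(rposneg f) {1}(rposneg g) /= addrACA opprD.
rewrite rsumB; do ?[exact: abs_summableD|by move=> i; rewrite addr_ge0 ?pn0].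
rewrite !ge0_norm1D//; try by move=> i; rewrite pn0.
by rewrite !rsumE// addrACA opprD.
Qed.

Lemma rsumZ c f : abs_summable f -> rsum (fun i => c * f i) = c * rsum f.
Proof.
move=> sf; have [spf snf] := (rpos_summable sf, rneg_summable sf).
have [c0|c0] := leP 0 c.
- have -> : (fun i => c * f i) = (fun i => c * rpos f i) \- (fun i => c * rneg f i).
    by apply/funext => i; rewrite {1}(rposneg f) /= mulrBr.
  rewrite rsumB; do ?[exact: abs_summableZ|by move=> i; rewrite mulr_ge0 ?rpos_ge0 ?rneg_ge0].
  by rewrite !norm1Z// ger0_norm// rsumE// mulrBr.
- have -> : (fun i => c * f i) = (fun i => - c * rneg f i) \- (fun i => - c * rpos f i).
    by apply/funext => i; rewrite {1}(rposneg f) /= mulrBr !mulNr opprK addrC.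
  rewrite rsumB; do ?[exact: abs_summableZ|by move=> i; rewrite mulr_ge0 ?rpos_ge0 ?rneg_ge0 ?oppr_ge0 ?ltW].
  by rewrite !norm1Z// normrN ltr0_norm// rsumE// mulrBr !mulNr opprK addrC.
Qed.

Lemma ler_norm_rsum f : abs_summable f -> `|rsum f| <= norm1 f.
Proof.
move=> sf; rewrite rsumE// (le_trans (ler_normB _ _))//.
rewrite !ger0_norm ?norm1_ge0// -ge0_norm1D.
- rewrite le_eqVlt; apply/orP; left; apply/eqP; congr fine.
  apply: eq_esum => i _; congr EFin; rewrite ger0_norm ?addr_ge0 ?rpos_ge0 ?rneg_ge0//.
  by rewrite /rpos /rneg /=; lra.
- exact: rpos_ge0.
- exact: rneg_ge0.
- exact: rpos_summable.
- exact: rneg_summable.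
Qed.

End UnorderedSum.

Section l1.
Variables (R : realType) (I : choiceType).

Definition l1_pred : {pred I -> R} := mem [set a : I -> R | abs_summable a].

Lemma l1_submod_closed : submod_closed l1_pred.
Proof.
split=> [|c f g].
  rewrite inE; rewrite /= abs_summableE esum1 // => i _; by rewrite normr0.
rewrite !inE /= => sf sg; apply: abs_summableD => //; exact: abs_summableZ.
Qed.

HB.instance Definition _ :=
  GRing.isSubmodClosed.Build R (I -> R) l1_pred l1_submod_closed.

Record l1 := L1 { l1_fun :> I -> R; l1P : l1_fun \in l1_pred }.

HB.instance Definition _ := [isSub for l1_fun].
HB.instance Definition _ := [Choice of l1 by <:].
HB.instance Definition _ := [SubChoice_isSubLmodule of l1 by <:].

Lemma l1_summable (a : l1) : abs_summable a.
Proof. by have := l1P a; rewrite inE. Qed.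

Definition l1_norm (a : l1) : R := norm1 a.

Lemma l1_normD (a b : l1) : l1_norm (a + b) <= l1_norm a + l1_norm b.
Proof. exact: norm1D (l1_summable a) (l1_summable b). Qed.

Lemma l1_normZ (c : R) (a : l1) : l1_norm (c *: a) = `|c| * l1_norm a.
Proof. exact: norm1Z (l1_summable a). Qed.

Lemma l1_norm_eq0 (a : l1) : l1_norm a = 0 -> a = 0.
Proof.
by move=> a0; apply/val_inj/funext => i; apply: norm1_eq0 a0 i; exact: l1_summable.
Qed.

HB.instance Definition _ :=
  Lmodule_isNormed.Build R l1 l1_normD l1_normZ l1_norm_eq0.

End l1.

Section linfty.
Variables (R : realType) (I : Type).

Definition linfty_pred : {pred I -> R} := mem (bounded_fun : set (I -> R)).

Lemma linftyP (f : I -> R) :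
  f \in linfty_pred <-> exists M, forall i, `|f i| <= M.
Proof.
rewrite inE /=; split.
  by move=> [M [_ fM]]; exists (M + 1) => i; apply: fM; rewrite // ltrDl.
move=> [M fM]; exists M; split=> [|N MN i _ /=]; first exact: num_real.
exact: le_trans (fM i) (ltW MN).
Qed.

Lemma linfty_submod_closed : submod_closed linfty_pred.
Proof.
split=> [|c f g].
  by apply/linftyP; exists 0 => i; rewrite normr0.
move=> /linftyP[M fM] /linftyP[N gN]; apply/linftyP.
exists (`|c| * M + N) => i; rewrite (le_trans (ler_normD _ _))// lerD//.
by rewrite normrM ler_wpM2l.
Qed.

HB.instance Definition _ :=
  GRing.isSubmodClosed.Build R (I -> R) linfty_pred linfty_submod_closed.

Record linfty := Linfty { linfty_fun :> I -> R; linfty_mem : linfty_fun \in linfty_pred }.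

HB.instance Definition _ := [isSub for linfty_fun].
HB.instance Definition _ := [Choice of linfty by <:].
HB.instance Definition _ := [SubChoice_isSubLmodule of linfty by <:].

Definition linfty_norm (f : linfty) : R := sup (range (fun i => `|f i|)).

Lemma linfty_norm_ge (f : linfty) i : `|f i| <= linfty_norm f.
Proof.
have /linftyP[M fM] := linfty_mem f.
by apply: ub_le_sup; [exists M => _ [j _ <-]; exact: fM|exists i].
Qed.

Lemma linfty_norm_le (f : linfty) M : 0 <= M -> (forall i, `|f i| <= M) ->
  linfty_norm f <= M.
Proof.
move=> M0 fM; rewrite /linfty_norm.
have [->|/set0P E0] := eqVneq (range (fun i => `|f i|)) set0; first by rewrite sup0.
by apply: ge_sup => // _ [i _ <-]; exact: fM.
Qed.

Lemma linfty_norm_ge0 (f : linfty) : 0 <= linfty_norm f.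
Proof.
rewrite /linfty_norm.
have [->|/set0P[_ [i _ _]]] := eqVneq (range (fun i => `|f i|)) set0.
  by rewrite sup0.
exact: le_trans (normr_ge0 (f i)) (linfty_norm_ge f i).
Qed.

Lemma linfty_normD (f g : linfty) :
  linfty_norm (f + g) <= linfty_norm f + linfty_norm g.
Proof.
apply: linfty_norm_le => [|i]; first by rewrite addr_ge0 ?linfty_norm_ge0.
by rewrite (le_trans (ler_normD (f i) (g i)))// lerD ?linfty_norm_ge.
Qed.

Lemma linfty_normZ_le (c : R) (f : linfty) :
  linfty_norm (c *: f) <= `|c| * linfty_norm f.
Proof.
apply: linfty_norm_le => [|i]; first by rewrite mulr_ge0 ?linfty_norm_ge0.
by rewrite [leLHS](normrM c (f i)) ler_wpM2l ?linfty_norm_ge.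
Qed.

Lemma linfty_normZ (c : R) (f : linfty) :
  linfty_norm (c *: f) = `|c| * linfty_norm f.
Proof.
apply/eqP; rewrite eq_le linfty_normZ_le /=.
have [->|c0] := eqVneq c 0; first by rewrite normr0 mul0r linfty_norm_ge0.
rewrite -ler_pdivlMl ?normr_gt0// -normfV.
by rewrite -{1}[f](scalerK c0) linfty_normZ_le.
Qed.

Lemma linfty_norm_eq0 (f : linfty) : linfty_norm f = 0 -> f = 0.
Proof.
move=> f0; apply/val_inj/funext => i; apply/eqP.
by rewrite -normr_le0 -f0 linfty_norm_ge.
Qed.

HB.instance Definition _ :=
  Lmodule_isNormed.Build R linfty linfty_normD linfty_normZ linfty_norm_eq0.

End linfty.

Section Hankel.
Variables (R : realType) (Sigma : finType) (L : set (seq Sigma)).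
Local Notation word := (seq Sigma).

Definition hankel_fun (a : word -> R) : word -> R :=
  fun v => rsum (fun u => a u * \1_L (u ++ v)).

Lemma hankel_le (a : word -> R) v u : `|a u * \1_L (u ++ v)| <= `|a u|.
Proof.
rewrite normrM ler_piMr// /indic; case: (_ \in _) => /=.
- by rewrite normr1.
- by rewrite normr0.
Qed.

Lemma hankel_summable (a : word -> R) v : abs_summable a ->
  abs_summable (fun u => a u * \1_L (u ++ v)).
Proof. by apply: abs_summable_le => u; exact: hankel_le. Qed.

Lemma hankel_fun_le (a : l1 R word) v : `|hankel_fun a v| <= norm1 a.
Proof.
have sa := l1_summable a; have sh := hankel_summable v sa.
rewrite (le_trans (ler_norm_rsum sh))// -lee_fin !norm1E//.
by apply: le_esum => u _; rewrite lee_fin hankel_le.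
Qed.

Lemma hankel_mem (a : l1 R word) : hankel_fun a \in @linfty_pred R word.
Proof. by apply/linftyP; exists (norm1 a) => v; exact: hankel_fun_le. Qed.

Definition hankel (a : l1 R word) : linfty R word := Linfty (hankel_mem a).

Lemma hankel_is_linear : linear hankel.
Proof.
move=> c a b; apply/val_inj/funext => v /=; rewrite /hankel_fun.
have [sa sb] := (hankel_summable v (l1_summable a), hankel_summable v (l1_summable b)).
rewrite -[RHS]/(c * rsum _ + rsum _) -rsumZ// -rsumD//; last exact: abs_summableZ.
by congr rsum; apply/funext => u /=; rewrite mulrDl mulrA.
Qed.

HB.instance Definition _ :=
  GRing.isLinear.Build R (l1 R word) (linfty R word) *:%R hankel hankel_is_linear.

Lemma hankel_bounded : bounded_op _ _ (hankel : {linear l1 R word -> linfty R word}).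
Proof.
apply/linear_bounded_continuous/bounded_funP => r; exists r => a ar.
apply: linfty_norm_le => [|v]; first exact: le_trans ar.
exact: le_trans (hankel_fun_le a v) ar.
Qed.

End Hankel.
Arguments hankel R {Sigma} L.

(* Main.v *)
Require Import Defs.
From HB Require Import structures.
From mathcomp Require Import all_boot all_order all_algebra.
From mathcomp Require Import finmap lra.
From mathcomp Require Import all_classical all_reals all_analysis.

(** Everything is read off the images of the unit vectors [delta u]: the operator
    [H] sends [delta u] to the characteristic function of the residual language
    of [u], the set of all [v] with [u ++ v] in [L].  By the Myhill-Nerode theorem
    [L] is regular exactly when it has finitely many residual languages.

    If [L] is regular, [H a] is a combination of finitely many characteristic
    functions, one for each state of an automaton: group the sum over [u] by the
    state reached on reading [u].  Thus [H] has finite rank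
    ([regular_hankel_finite_rank]); being bounded, it is also compact
    ([finite_rank_compact]), and both distances vanish.

    If [L] is not regular, there are infinitely many words with pairwise
    different residuals, whose images under [H] are pairwise at distance at
    least [1] since they take the values [0] and [1] only.  A compact [S] has
    to send two of the corresponding unit vectors almost to the same point,
    so that [1 <= 2 * `|H - S| + epsilon]; hence no compact operator is closer
    to [H] than [1/2] ([hankel_compact_distance]).  Conversely the values [0]
    and [1] are both at distance [1/2] from the constant [1/2]: the
    rank-one operator that sends [a] to the constant function [1/2 * \sum_u a u]
    is at distance at most [1/2] from [H] ([hankel_half_sum_distance]).
    Finite-rank bounded operators, compact operators and operators of rank
    less than [n], for [n >= 2], all lie between these two extremes, so that the
    three infima are [1/2] ([nonregular_hankel_dist]). *)

Set Implicit Arguments.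
Unset Strict Implicit.
Unset Printing Implicit Defensive.

Import Order.TTheory GRing.Theory Num.Theory.
Import numFieldNormedType.Exports.

Local Open Scope classical_set_scope.
Local Open Scope ring_scope.

(** * Operator norm and distances *)

Section OperatorNorm.
Variables (R : realType) (X Y : normedModType R).
Implicit Types (S T : {linear X -> Y}) (M : set {linear X -> Y}).

Lemma bounded_opP T : bounded_op X Y T ->
  exists2 r, 0 <= r & forall x, `|T x| <= r * `|x|.
Proof.
move=> /linear_bounded_continuous/linear_boundedP/pinfty_ex_gt0[r r0 Tr].
by exists r => //; exact: ltW.
Qed.

Lemma bounded_opI T r : (forall x, `|T x| <= r * `|x|) -> bounded_op X Y T.
Proof.
move=> Tr; apply/linear_bounded_continuous/bounded_funP => s.
exists (`|r| * s) => x xs; apply: le_trans (Tr x) _.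
by rewrite (le_trans (ler_norm _))// normrM normr_id ler_wpM2l.
Qed.

Lemma op_norm_ge0 (f : X -> Y) : 0 <= op_norm f.
Proof.
rewrite /op_norm; set E := (X in sup X).
have [[_ [M EM]]|/sup_out->//] := pselect (has_sup E).
apply: (@le_trans _ _ `|f 0|) => //.
by apply: ub_le_sup; [exists M|exists 0 => //=; rewrite normr0].
Qed.

Lemma op_norm_le (f : X -> Y) c :
  (forall x, `|x| <= 1 -> `|f x| <= c) -> op_norm f <= c.
Proof.
move=> fc; apply: ge_sup; last by move=> _ [x /= x1 <-]; exact: fc.
by exists `|f 0|; exists 0 => //=; rewrite normr0.
Qed.

(** [op_norm] is a supremum with default value [0], so it controls the values of a
    map only once that map is known to be bounded on the unit ball. *)
Lemma op_normB_ge S T x : bounded_op X Y S -> bounded_op X Y T ->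
  `|x| <= 1 -> `|T x - S x| <= op_norm (T \- S).
Proof.
move=> /bounded_opP[s s0 Ss] /bounded_opP[t t0 Tt] x1.
apply: ub_le_sup; last by exists x.
exists (t + s) => _ [y /= y1 <-].
apply: le_trans (ler_normB _ _) _; apply: lerD.
  by rewrite (le_trans (Tt y))// ler_piMr.
by rewrite (le_trans (Ss y))// ler_piMr.
Qed.

Lemma op_dist_le T S M : M S -> op_dist T M <= op_norm (T \- S).
Proof.
move=> MS; apply: ge_inf; last by exists S.
by exists 0 => _ [? _ <-]; exact: op_norm_ge0.
Qed.

Lemma op_dist_ge T M c : M !=set0 -> (forall S, M S -> c <= op_norm (T \- S)) ->
  c <= op_dist T M.
Proof.
move=> [S MS] cM; apply: lb_le_inf; first by exists (op_norm (T \- S)), S.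
by move=> _ [U MU <-]; exact: cM.
Qed.

Lemma op_dist_mem T M : M T -> op_dist T M = 0.
Proof.
move=> MT; apply/eqP; rewrite eq_le; apply/andP; split; last first.
  by apply: op_dist_ge; [exists T|move=> S _; exact: op_norm_ge0].
apply: le_trans (op_dist_le T MT) _.
by apply: op_norm_le => x _ /=; rewrite subrr normr0.
Qed.

End OperatorNorm.

(** * Finite rank and compactness *)

Section FiniteRank.
Variables (R : realType) (Y : normedModType R).

(** Coordinates are taken in ['rV_k] to have its norm and the compactness of its
    closed bounded sets at hand. *)
Definition combination k (e : 'I_k -> Y) (c : 'rV[R]_k) : Y :=
  \sum_(i < k) c ord0 i *: e i.

Lemma combinationZ k (e : 'I_k -> Y) a c :
  combination e (a *: c) = a *: combination e c.
Proof. by rewrite scaler_sumr; apply: eq_bigr => i _; rewrite mxE scalerA. Qed.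

Lemma continuous_combination k (e : 'I_k -> Y) : continuous (combination e).
Proof.
move=> c; rewrite /combination.
apply: (@cvg_big _ _ _ 0 xpredT (@pseudometric_normed_Zmodule.add_continuous _ Y) _ (nbhs c) _ (fun i d => d ord0 i *: e i)) => i _.
by apply: cvgZ; [exact: coord_continuous|exact: cvg_cst].
Qed.

(** The equivalence of norms on a finite-dimensional space: the continuous function
    [c |-> `|combination e c|] attains its minimum on the compact unit sphere,
    and linear independence makes this minimum positive. *)
Lemma lin_indep_lower_bound k (e : 'I_k -> Y) : lin_indep e ->
  exists2 m, 0 < m & forall c, m * `|c| <= `|combination e c|.
Proof.
move=> indep; pose A := [set c : 'rV[R]_k | `|c| = 1].
have cA : compact A.
  apply: bounded_closed_compact.
    by exists 1; split=> [|x x1 c /= ->]; [exact: num_real|exact: ltW].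
  rewrite (_ : A = (fun c => `|c|) @^-1` [set 1]) //.
  by apply: closed_comp; [move=> c _; exact: norm_continuous|exact: closed_eq].
have inA c : c != 0 -> A (`|c|^-1 *: c).
  by move=> c0; rewrite /A /= normrZ normfV normr_id mulVf// normr_eq0.
(* The unit sphere is empty when [k = 0], and then any [m] will do. *)
have [A0|A0] := pselect (A !=set0); last first.
  exists 1 => // c; have [->|c0] := eqVneq c 0; first by rewrite normr0 mulr0.
  by exfalso; apply: A0; exists (`|c|^-1 *: c); exact: inA.
have cf : continuous (fun c => `|combination e c|).
  move=> c; apply: continuous_comp; first exact: continuous_combination.
  exact: norm_continuous.
have [c /[!inE] c1 cmin] := compact_EVT_min A0 cA (continuous_subspaceT cf).
exists `|combination e c|.
  rewrite normr_gt0; apply/eqP => /indep ci.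
  move: c1; rewrite /A /= (_ : c = 0) ?normr0; first by move/eqP; rewrite eq_sym oner_eq0.
  by apply/rowP => i; rewrite ci mxE.
move=> d; have [->|d0] := eqVneq d 0; first by rewrite normr0 mulr0.
have := cmin _ (mem_set (inA _ d0)).
by rewrite combinationZ normrZ normfV normr_id ler_pdivlMl ?normr_gt0// mulrC.
Qed.

(** The image of the unit ball is bounded, so by [lin_indep_lower_bound] the
    coordinates of its points are bounded as well, and it lies in the continuous
    image of a compact set of coordinates. *)
Lemma finite_rank_compact (X : normedModType R) :
  finite_rank_op X Y `<=` compact_op X Y.
Proof.
move=> T [bT [k [e indep rT]]]; split=> //.
have [m m0 me] := lin_indep_lower_bound indep.
have [r r0 Tr] := bounded_opP bT.
pose B := [set c : 'rV[R]_k | `|c| <= r / m].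
have cB : compact B.
  apply: bounded_closed_compact.
    exists (r / m); split=> [|x x1 c /= cr]; first exact: num_real.
    exact: le_trans cr (ltW x1).
  rewrite (_ : B = (fun c => `|c|) @^-1` [set x | x <= r / m]) //.
  by apply: closed_comp; [move=> c _; exact: norm_continuous|exact: closed_le].
have cD : compact (combination e @` B).
  by apply: continuous_compact cB; apply: continuous_subspaceT; exact: continuous_combination.
apply: precompact_subset (compact_precompact (@norm_hausdorff _ _) cD).
move=> _ [x /= x1 <-].
have : range T (T x) by exists x.
rewrite rT => -[c _ cT].
have cE : combination e (\row_i c i) = T x.
  by rewrite -cT; apply: eq_bigr => i _; rewrite mxE.
exists (\row_i c i) => //=; rewrite /B /= ler_pdivlMr// mulrC.
apply: le_trans (me _) _; rewrite cE; by rewrite (le_trans (Tr x))// ler_piMr.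
Qed.

(** A cluster point of the sequence has terms of arbitrarily large index nearby,
    in particular two of them with different indices. *)
Lemma precompact_pigeonhole (A : set Y) (u : nat -> Y) eps : precompact A ->
  (forall n, A (u n)) -> 0 < eps ->
  exists n m, (n < m)%N /\ `|u n - u m| < eps.
Proof.
rewrite precompactE => cA Au e0.
have : (u @ \oo) (closure A) by exists 0%N => // n _; apply: subset_closure; exact: Au.
move=> /(cA _ _)[p [_ clp]].
have he : 0 < eps / 2 by rewrite divr_gt0.
have tail N : exists2 n, (N <= n)%N & `|p - u n| < eps / 2.
  have FN : (u @ \oo) (u @` [set n | (N <= n)%N]) by exists N => // n Nn; exists n.
  have [_ [[n Nn <-] un]] := clp _ _ FN (nbhsx_ballx p _ he).
  by exists n => //; rewrite -ball_normE in un.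
have [n _ pn] := tail 0%N; have [m nm pm] := tail n.+1.
exists n, m; split=> //; rewrite (splitr eps).
by rewrite (le_lt_trans (ler_distD p _ _))// ltrD// distrC.
Qed.

(** As long as there is a linear relation between the vectors, one of them can be
    dropped without changing the span. *)
Lemma independent_spanning_subfamily k (e : 'I_k -> Y) : exists k' (f : 'I_k' -> Y), lin_indep f /\
  [set \sum_(i < k) c i *: e i | c in [set: 'I_k -> R]] =
  [set \sum_(i < k') c i *: f i | c in [set: 'I_k' -> R]].
Proof.
elim: k e => [|k IH] e; first by exists 0%N, e; split=> // c _ [].
have [ei|] := pselect (lin_indep e); first by exists k.+1, e.
move=> /existsNP[c /not_implyP[c0 /existsNP[i /eqP ci]]].
have [k' [f [fi ef]]] := IH (fun j => e (lift i j)).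
exists k', f; split=> //; rewrite -ef.
have split_at d : \sum_(j < k.+1) d j *: e j =
    d i *: e i + \sum_(j < k) d (lift i j) *: e (lift i j).
  by rewrite (bigD1_ord i).
apply/seteqP; split=> _ [d _ <-].
  exists (fun j => d (lift i j) - d i / c i * c (lift i j)) => //.
  (* Subtracting the multiple [d i / c i] of the relation [c] cancels the
     coefficient of [e i]. *)
  transitivity (\sum_(j < k.+1) (d j - d i / c i * c j) *: e j).
    by rewrite split_at divfK// subrr scale0r add0r.
  under eq_bigr do rewrite scalerBl -scalerA.
  by rewrite sumrB -scaler_sumr c0 scaler0 subr0.
exists (fun j => if unlift i j is Some j' then d j' else 0) => //.
rewrite split_at unlift_none scale0r add0r.
by apply: eq_bigr => j _; rewrite liftK.
Qed.

End FiniteRank.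

(** * The Myhill-Nerode theorem *)

Section Nerode.
Variables (Sigma : finType) (L : set (seq Sigma)).

Definition residual (u : seq Sigma) : set (seq Sigma) := [set v | L (u ++ v)].

(** The residuals themselves are the states of an automaton: reading a letter [c]
    leads from the residual of [w] to that of [rcons w c], which depends on
    the residual of [w] only, and a residual is accepting when it contains the
    empty word. *)
Lemma finite_residuals_regular : finite_set (range residual) -> regular L.
Proof.
move=> fin; pose Q := fset_set (range residual).
have resQ u : residual u \in Q by rewrite in_fset_set//; apply/mem_set; exists u.
pose q0 : Q := [` resQ [::]]%fset.
(* The default value [q0] of [insubd] is never reached, by [run] below. *)
pose step (q : Q) (c : Sigma) : Q := insubd q0 [set v | val q (c :: v)].
pose A := @DFA Sigma Q q0 step [set q : Q | `[< val q [::] >]]%SET.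
have run w : val (foldl step q0 w) = residual w.
  elim/last_ind: w => // w c IH; rewrite foldl_rcons val_insubd IH.
  have -> : [set v | residual w (c :: v)] = residual (rcons w c).
    by apply/seteqP; split=> v; rewrite /residual /= cat_rcons.
  by rewrite resQ.
exists A; apply/seteqP; split=> w;
  by rewrite /= /dfa_accepts inE /= run /residual /= cats0 => /asboolP.
Qed.

Lemma nonregular_residual_sequence : ~ regular L ->
  exists w : nat -> seq Sigma, injective (residual \o w).
Proof.
move=> nreg.
have /infiniteP/pcard_leP[f] : ~ finite_set (range residual).
  by move=> /finite_residuals_regular.
have /choice[w wf] n : exists u, residual u = f n.
  by have [u _ uf] := @funS _ _ _ _ f n I; exists u.
exists w => m n /=; rewrite !wf; apply: (@inj _ _ _ f); exact: in_setT.
Qed.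

End Nerode.

(** * Summable families and unit vectors *)

Section Summation.
Variables (R : realType) (I : choiceType).
Implicit Types f g : I -> R.

Lemma norm1_le f g : (forall i, `|f i| <= `|g i|) -> abs_summable g ->
  norm1 f <= norm1 g.
Proof.
move=> fg sg; have sf := abs_summable_le fg sg.
by rewrite -lee_fin !norm1E//; apply: le_esum => i _; rewrite lee_fin.
Qed.

Lemma rsum_sum (J : finType) (F : J -> I -> R) :
  (forall j, abs_summable (F j)) ->
  rsum (fun i => \sum_j F j i) = \sum_j rsum (F j).
Proof.
move=> sF.
suff /(_ (index_enum J))[] : forall r : seq J,
    abs_summable (fun i => \sum_(j <- r) F j i) /\
    rsum (fun i => \sum_(j <- r) F j i) = \sum_(j <- r) rsum (F j) by [].
elim=> [|j r [sr rr]].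
  rewrite big_nil; have -> : (fun i => \sum_(j <- [::]) F j i) = (0 : l1 R I).
    by apply/funext => i; rewrite big_nil.
  split; first exact: l1_summable.
  rewrite (_ : l1_fun _ = fun i => 0 * (0 : l1 R I) i); last by apply/funext => i; rewrite mul0r.
  by rewrite rsumZ ?mul0r//; exact: l1_summable.
have -> : (fun i => \sum_(j <- j :: r) F j i) = F j \+ (fun i => \sum_(j <- r) F j i).
  by apply/funext => i; rewrite big_cons.
by rewrite big_cons rsumD// rr; split=> //; exact: abs_summableD.
Qed.

Let delta_fun (j i : I) : R := (i == j)%:R.

Lemma esum_delta j : (\esum_(i in [set: I]) `|delta_fun j i|%:E = 1)%E.
Proof.
rewrite -(@esum_set1 R I j (fun=> 1%E))// [RHS]esum_mkcond.
apply: eq_esum => i _; rewrite /delta_fun in_set1.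
by case: eqP => _; rewrite ?normr1 ?normr0.
Qed.

Lemma delta_mem j : delta_fun j \in @l1_pred R I.
Proof. by apply: mem_set; rewrite /= abs_summableE esum_delta ltry. Qed.

Definition delta j : l1 R I := L1 (delta_mem j).

Lemma norm_delta j : `|delta j| = 1.
Proof. by rewrite -[LHS]/(fine _) esum_delta. Qed.

Lemma rsum_delta j : rsum (delta j) = 1.
Proof.
rewrite rsumE; last exact: l1_summable.
have -> : rpos (delta j) = delta j.
  by apply/funext => i; rewrite /rpos /= /delta_fun normr_nat; lra.
have -> : rneg (delta j) = (0 : l1 R I).
  by apply/funext => i; rewrite /rneg /= /delta_fun normr_nat subrr mul0r.
by rewrite -[X in X - _]/`|delta j| -[X in _ - X]/`|0 : l1 R I| norm_delta normr0 subr0.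
Qed.

End Summation.

(** * The Hankel operator *)

Section HankelOperator.
Variables (R : realType) (Sigma : finType) (L : set (seq Sigma)).
Local Notation word := (seq Sigma).
Local Notation X := (l1 R word).
Local Notation Y := (linfty R word).
Local Notation delta := (@delta R word).
Let H : {linear X -> Y} := hankel R L.

Lemma hankel_delta u v : hankel R L (delta u) v = \1_L (u ++ v).
Proof.
rewrite -[RHS]mulr1 -(rsum_delta _ u) -rsumZ; last exact: l1_summable.
rewrite -[LHS]/(rsum _); congr rsum; apply/funext => x /=.
by have [->|] := eqVneq x u; rewrite ?mul1r ?mulr1// mul0r mulr0.
Qed.

(** Two residuals that differ at a word [v] give the values [0] and [1] there. *)
Lemma hankel_separation u u' : residual L u <> residual L u' ->
  1 <= `|hankel R L (delta u) - hankel R L (delta u')|.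
Proof.
move=> neq.
have [v] : exists v, \1_L (u ++ v) != \1_L (u' ++ v) :> R.
  apply: contrapT => /forallNP eq; apply: neq; apply/seteqP.
  have {}eq v : ((u ++ v) \in L) = ((u' ++ v) \in L).
    have /negP/negPn := eq v; rewrite /indic eqr_nat.
    by do 2!case: (_ \in L).
  by split=> v; rewrite /residual /= => /mem_set; [rewrite eq|rewrite -eq] => /set_mem.
rewrite -!hankel_delta => neqv.
apply: le_trans (linfty_norm_ge _ v) => /=.
rewrite -[X in `|X|]/(hankel R L (delta u) v - hankel R L (delta u') v).
move: neqv; rewrite !hankel_delta /indic.
do 2!case: (_ \in L); rewrite ?eqxx ?subr0 ?sub0r ?normrN ?normr1//.
Qed.

(** Among infinitely many unit vectors with pairwise different residuals, the compact
    operator [S] sends two to nearly equal points, while [hankel R L] keeps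
    their images at distance [1]; one of the two images is therefore moved by
    [hankel R L - S] by almost [1/2]. *)
Lemma hankel_compact_distance (S : {linear X -> Y}) : ~ regular L ->
  compact_op X Y S -> 2^-1 <= op_norm (hankel R L \- S).
Proof.
move=> /nonregular_residual_sequence[w winj] [bS cS].
apply/ler_addgt0Pr => e e0.
have [||n [m [nm Snm]]] := precompact_pigeonhole (u := fun n => S (delta (w n))) (eps := e *+ 2) cS.
- by move=> n; exists (delta (w n)) => //=; rewrite norm_delta.
- by rewrite mulrn_wgt0.
have sep : residual L (w n) <> residual L (w m).
  by move=> /winj nmE; rewrite nmE ltnn in nm.
have near k : `|hankel R L (delta (w k)) - S (delta (w k))| <= op_norm (hankel R L \- S).
  apply: (@op_normB_ge _ _ _ S H) => //; first exact: hankel_bounded.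
  by rewrite norm_delta.
have := hankel_separation sep; have := near n; have := near m.
set a := hankel R L _; set b := hankel R L _; set c := S _; set d := S _.
move: Snm; rewrite -/c -/d => dc am bn sepab.
have tri : `|b - a| <= `|b - d| + (`|d - c| + `|a - c|).
  rewrite (le_trans (ler_distD d _ _))// lerD2l.
  by rewrite (le_trans (ler_distD c _ _))// lerD2l distrC.
have : 1 <= op_norm (hankel R L \- S) * 2 + e * 2 by lra.
lra.
Qed.

(** The constant [2^-1] is the midpoint of the two values that a characteristic
    function takes; this operator sends every unit vector to that constant. *)
Definition half_sum_fun (a : X) : word -> R := fun=> 2^-1 * rsum a.

Lemma half_sum_mem a : half_sum_fun a \in @linfty_pred R word.
Proof. by apply/linftyP; exists `|2^-1 * rsum a|. Qed.

Definition half_sum (a : X) : Y := Linfty (half_sum_mem a).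

Lemma half_sum_is_linear : linear half_sum.
Proof.
move=> c a b; apply/val_inj/funext => v.
rewrite -[LHS]/(2^-1 * rsum ((fun i => c * a i) \+ b)).
rewrite -[RHS]/(c * (2^-1 * rsum a) + 2^-1 * rsum b).
have [sa sb] := (l1_summable a, l1_summable b).
by rewrite rsumD ?rsumZ//; [rewrite mulrDr mulrCA|exact: abs_summableZ].
Qed.

HB.instance Definition _ :=
  GRing.isLinear.Build R X Y *:%R half_sum half_sum_is_linear.

Lemma half_sum_bounded : bounded_op X Y half_sum.
Proof.
apply: (@bounded_opI _ _ _ _ 2^-1) => a; apply: linfty_norm_le => [|v].
  by rewrite mulr_ge0.
rewrite -[X in X <= _]/`|2^-1 * rsum a| normrM ger0_norm// ler_wpM2l//.
by apply: ler_norm_rsum; exact: l1_summable.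
Qed.

Lemma half_sum_rank1 : has_rank half_sum 1.
Proof.
have half_delta a : half_sum a = rsum a *: half_sum (delta [::]).
  apply/val_inj/funext => v.
  rewrite -[RHS]/(rsum a * (2^-1 * rsum (delta [::]))) rsum_delta.
  by rewrite mulr1 mulrC.
exists (fun=> half_sum (delta [::])).
  move=> c; rewrite big_ord1 => /(congr1 (fun f : Y => f [::])).
  rewrite -[LHS]/(c ord0 * (2^-1 * rsum (delta [::]))) rsum_delta -[RHS]/0.
  by move=> c0 i; rewrite ord1; lra.
apply/seteqP; split=> [_ [a _ <-]|_ [c _ <-]].
  by exists (fun=> rsum a) => //; rewrite big_ord1 -half_delta.
by exists (c ord0 *: delta [::]) => //; rewrite big_ord1 linearZ.
Qed.

Lemma hankel_half_sum_distance : op_norm (hankel R L \- half_sum) <= 2^-1.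
Proof.
apply: op_norm_le => a a1; apply: linfty_norm_le => // v.
have sa := l1_summable a; have sh := hankel_summable L v sa.
rewrite -[X in `|X|]/(rsum (fun u => a u * \1_L (u ++ v)) - 2^-1 * rsum a).
rewrite -mulNr -rsumZ// -rsumD//; last exact: abs_summableZ.
apply: le_trans (ler_norm_rsum _) _; first by apply: abs_summableD => //; exact: abs_summableZ.
apply: (@le_trans _ _ (norm1 (fun u => 2^-1 * a u))).
  apply: norm1_le => [u|]; last exact: abs_summableZ.
  rewrite /= (mulrC (a u)) -mulrDl !normrM ler_wpM2r//.
  rewrite /indic; case: (_ \in L) => /=; rewrite ler_norml ger0_norm//; lra.
rewrite norm1Z// ger0_norm// ler_piMr//.
Qed.

(** With [run u] the state reached on [u], the value [\1_L (u ++ v)] depends on [u]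
    through [run u] only.  Grouping the words by this state writes [H a] as a
    combination of the vectors [H (delta (w q))], where [w q] is some word that
    leads to [q].  Taking these vectors rather than the languages accepted
    from each state keeps them inside the range of [H] even if [q] is
    unreachable, so that their span is exactly that range. *)
Lemma regular_hankel_finite_rank : regular L -> finite_rank H.
Proof.
move=> [A LA]; pose run w := foldl (@dfa_step _ A) (dfa_start A) w.
have LE u v : \1_L (u ++ v) =
    (foldl (@dfa_step _ A) (run u) v \in dfa_accept A)%:R :> R.
  rewrite /indic LA; congr (_%:R); congr nat_of_bool.
  rewrite /run -foldl_cat -[RHS]/(dfa_accepts A (u ++ v)).
  by apply/idP/idP => [/set_mem//|?]; exact/mem_set.
(* For an unreachable state [w q] is the empty word; no word [u] then has
   [run u = q], so that its coefficient in [HE] is [0]. *)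
pose w q := xget [::] [set u | run u = q].
have runw u : run (w (run u)) = run u by apply: (@xgetI _ [::] [set u' | run u' = run u] u).
pose part q (a : X) : word -> R := fun u => a u * (run u == q)%:R.
have spart q a : abs_summable (part q a).
  apply: abs_summable_le (l1_summable a) => u; rewrite normrM ler_piMr//.
  by rewrite normr_nat; case: eqP.
have HE a : H a = \sum_q rsum (part q a) *: H (delta (w q)).
  apply/val_inj/funext => v.
  have -> : val (\sum_q rsum (part q a) *: H (delta (w q))) v =
      \sum_q rsum (part q a) * \1_L (w q ++ v).
    rewrite (big_morph (fun f : Y => val f v) (id1 := 0) (op1 := +%R))//.
    by apply: eq_bigr => q _; rewrite -hankel_delta.
  under eq_bigr do rewrite mulrC -rsumZ//.
  rewrite -rsum_sum => [|q]; last exact: abs_summableZ.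
  rewrite -[LHS]/(rsum _); congr rsum; apply/funext => u.
  rewrite (bigD1 (run u))//= big1 ?addr0 => [|q /negbTE qu].
    by rewrite /part eqxx mulr1 mulrC; congr (_ * _); rewrite !LE runw.
  by rewrite /part eq_sym qu !mulr0.
pose e (i : 'I_#|dfa_state A|) := H (delta (w (enum_val i))).
have [k [f [indep ef]]] := independent_spanning_subfamily e.
exists k, f => //; rewrite -ef; apply/seteqP; split=> [_ [a _ <-]|_ [c _ <-]].
  exists (fun i => rsum (part (enum_val i) a)) => //.
  by rewrite HE [RHS]big_enum_val.
exists (\sum_i c i *: delta (w (enum_val i))) => //.
by rewrite linear_sum; apply: eq_bigr => i _; rewrite linearZ.
Qed.

End HankelOperator.

(** The lower bound is inherited from the compact operators, and the upper bound
    only asks for one particular operator; all three classes of the theorem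
    satisfy both requirements. *)
Lemma nonregular_hankel_dist (R : realType) (Sigma : finType)
    (L : set (seq Sigma)) (M : set {linear l1 R (seq Sigma) -> linfty R (seq Sigma)}) :
  ~ regular L -> M `<=` compact_op _ _ -> M (@half_sum R Sigma) ->
  op_dist (hankel R L) M = 2^-1.
Proof.
move=> nreg Mcompact Mhalf; apply/eqP; rewrite eq_le; apply/andP; split.
  exact: le_trans (op_dist_le _ Mhalf) (hankel_half_sum_distance _ _).
apply: op_dist_ge => [|S /Mcompact]; first by exists (@half_sum R Sigma).
exact: hankel_compact_distance.
Qed.

Theorem theorem8p5 (R : realType) (Sigma : finType) (Sigma_gt0 : (0 < #|Sigma|)%N)
    (L : set (seq Sigma)) :
  let H : {linear l1 R (seq Sigma) -> linfty R (seq Sigma)} := hankel R L in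
  let F := finite_rank_op (l1 R (seq Sigma)) (linfty R (seq Sigma)) in
  let K := compact_op (l1 R (seq Sigma)) (linfty R (seq Sigma)) in
  (regular L -> finite_rank H /\ op_dist H F = 0 /\ op_dist H K = 0) /\
  (~ regular L ->
     [/\ op_dist H F = 2^-1, op_dist H K = 2^-1 &
         forall n : nat, (2 <= n)%N -> approx_number n H = 2^-1]).
Proof.
move=> H F K; have FK : F `<=` K by exact: finite_rank_compact.
split=> [reg|nreg].
  have rH : finite_rank H by exact: regular_hankel_finite_rank.
  have FH : F H by split=> //; exact: hankel_bounded.
  by split=> //; split; apply: op_dist_mem => //; exact: FK.
have Fhalf : F (@half_sum R Sigma).
  by split; [exact: half_sum_bounded|exists 1%N; exact: half_sum_rank1].
split; [exact: nonregular_hankel_dist| |move=> n n2].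
  by apply: nonregular_hankel_dist => //; exact: FK.
apply: nonregular_hankel_dist => //.
  by move=> S [bS [k _ rS]]; apply: FK; split=> //; exists k.
by split; [exact: half_sum_bounded|exists 1%N => //; exact: half_sum_rank1].
Qed.
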